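(* No infinite connected graph $G$ has an $\mathcal{F}$-root, i.e., there is no graph $H$ with $\mathcal{F}(H)\cong G$.
   Context: All graphs are simple (no loops or multiple edges), labeled, and may be infinite. A forest of $H$ is an acyclic subgraph; a maximal forest is a forest of $H$ not properly contained in another forest of $H$. The forest graph $\mathcal{F}(H)$ has as vertices the maximal forests of $H$, two being adjacent iff $F_2=F_1-e+f$ for some edges $e\in F_1$, $f\notin F_1$. *)

(* Defs.v *)
From mathcomp Require Import all_boot.
From mathcomp Require Import boolp classical_sets functions cardinality.

Set Implicit Arguments.
Unset Strict Implicit.
Unset Printing Implicit Defensive.

Local Open Scope classical_set_scope.

Record sgraph := SGraph {
  vertex : Type;
  adj : vertex -> vertex -> Prop;
  adj_sym : forall x y, adj x y -> adj y x;
  adj_irrefl : forall x, ~ adj x x }.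

(* The edge joining x and y is the unordered pair [set x; y]. *)
Definition edges (H : sgraph) : set (set (vertex H)) :=
  [set e | exists x y, adj x y /\ e = [set x; y]].

Definition infinite_graph (G : sgraph) : Prop := infinite_set [set: vertex G].

Definition connected_graph (G : sgraph) : Prop :=
  forall x y : vertex G, exists (n : nat) (p : nat -> vertex G),
    [/\ p 0 = x, p n = y & forall i, i < n -> adj (p i) (p i.+1)].

Definition graph_iso (G G' : sgraph) : Prop :=
  exists2 phi : vertex G -> vertex G', bijective phi &
    forall x y, adj x y <-> adj (phi x) (phi y).

Record subgraph (H : sgraph) := Subgraph {
  sub_vertices : set (vertex H);
  sub_edges : set (set (vertex H));
  sub_edgesH : sub_edges `<=` @edges H;
  sub_edges_ends : forall e, sub_edges e -> e `<=` sub_vertices }.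

Definition contained (H : sgraph) (F F' : subgraph H) : Prop :=
  sub_vertices F `<=` sub_vertices F' /\ sub_edges F `<=` sub_edges F'.

(* ordS is the cyclic successor, so the closing edge from c (n - 1) to c 0 is
   included. *)
Definition has_cycle (H : sgraph) (F : subgraph H) : Prop :=
  exists (n : nat) (c : 'I_n -> vertex H),
    [/\ 3 <= n, injective c & forall i, sub_edges F [set c i; c (ordS i)]].

Definition forest (H : sgraph) (F : subgraph H) : Prop := ~ has_cycle F.

Definition maximal_forest (H : sgraph) (F : subgraph H) : Prop :=
  forest F /\ ~ exists F', [/\ forest F', contained F F' & F' <> F].

(* F2 = F1 - e + f for some e in F1 and some f not in F1; that f is an edge of
   H follows from F2 being a subgraph of H. *)
Definition exchange (H : sgraph) (F1 F2 : subgraph H) : Prop :=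
  exists e f, [/\ sub_edges F1 e, ~ sub_edges F1 f,
    sub_vertices F2 = sub_vertices F1 &
    sub_edges F2 = (sub_edges F1 `\ e) `|` [set f]].

Lemma exchange_sym (H : sgraph) (F1 F2 : subgraph H) :
  exchange F1 F2 -> exchange F2 F1.
Proof.
move=> [e [f [F1e F1f eqV eqE]]]; exists f, e; rewrite eqE; split => //.
- by right.
- by case=> [[_ /=]|/= ef] //; apply: F1f; rewrite -ef.
- apply/seteqP; split=> g /=.
  + move=> F1g; have [->|ge] := EM (g = e); first by right.
    by left; split; [left|move=> gf; apply: F1f; rewrite -gf].
  + by case=> [[[[]|]]|->].
Qed.

Lemma exchange_irrefl (H : sgraph) (F : subgraph H) : ~ exchange F F.
Proof. by move=> [e [f [_ Ff _ eqE]]]; apply: Ff; rewrite eqE; right. Qed.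

Definition forest_graph (H : sgraph) : sgraph :=
  @SGraph {F : subgraph H | maximal_forest F}
    (fun F1 F2 => exchange (sval F1) (sval F2))
    (fun F1 F2 => @exchange_sym H (sval F1) (sval F2))
    (fun F => @exchange_irrefl H (sval F)).

Definition forest_root (H G : sgraph) : Prop := graph_iso (forest_graph H) G.

(* Main.v *)
(* Along a path of exchanges only finitely many edges change, so in a connected
   forest graph any two maximal forests differ in finitely many edges.  Fix a
   maximal forest F0 and let D be the set of edges of H outside F0.  If D is
   infinite, it contains an infinite acyclic set, which extends to a maximal
   forest at infinite distance from F0.  If D is finite, all cycles of H live on
   the finite union of the fundamental cycles of D, so H has only finitely many
   maximal forests. *)

From mathcomp Require Import all_boot.
From mathcomp Require Import boolp classical_sets functions cardinality.
Require Import Defs.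

Set Implicit Arguments.
Unset Strict Implicit.
Unset Printing Implicit Defensive.

Local Open Scope classical_set_scope.

(** * Cycles and walks in a set of edges *)

Definition cyclic (T : Type) (E : set (set T)) : Prop :=
  exists (n : nat) (c : 'I_n -> T),
    [/\ 3 <= n, injective c & forall i, E [set c i; c (ordS i)]].

Inductive walk (T : Type) (E : set (set T)) (x : T) : T -> Prop :=
| walk_refl : walk E x x
| walk_step y z : walk E x y -> E [set y; z] -> walk E x z.

Lemma set2_inj (T : Type) (x y a b : T) : [set x; y] = [set a; b] ->
  (x = a /\ y = b) \/ (x = b /\ y = a).
Proof.
move=> e.
have /= : [set a; b] x by rewrite -e; left.
have /= : [set a; b] y by rewrite -e; right.
have /= : [set x; y] a by rewrite e; left.
have /= : [set x; y] b by rewrite e; right.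
by intuition (subst; auto).
Qed.

Lemma walk_trans (T : Type) (E : set (set T)) (x y z : T) :
  walk E x y -> walk E y z -> walk E x z.
Proof.
by move=> xy; elim=> [//|u v _ xu uv]; apply: walk_step uv.
Qed.

Lemma walk_sym (T : Type) (E : set (set T)) (x y : T) :
  walk E x y -> walk E y x.
Proof.
elim=> [|u v _ ux uv]; first exact: walk_refl.
apply: walk_trans ux; apply: walk_step (walk_refl _ _) _.
by rewrite setUC.
Qed.

Lemma walk_sub (T : Type) (E E' : set (set T)) (x y : T) :
  (forall a b, E [set a; b] -> walk E' a b) -> walk E x y -> walk E' x y.
Proof.
move=> EE'; elim=> [|u v _ xu uv]; first exact: walk_refl.
exact: walk_trans xu (EE' _ _ uv).
Qed.

Lemma subset_cyclic (T : Type) (E E' : set (set T)) :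
  E `<=` E' -> cyclic E -> cyclic E'.
Proof. by move=> EE' [n [c [n3 ci cE]]]; exists n, c; split=> // i; apply: EE'. Qed.

Lemma val_iter_ordS (n k : nat) (i : 'I_n) :
  iter k (@ordS n) i = (i + k) %% n :> nat.
Proof.
elim: k => [|k IHk] /=; first by rewrite addn0 modn_small.
by rewrite IHk -addn1 modnDml addn1 addnS.
Qed.

Lemma iter_ordS_neq (n k : nat) (i : 'I_n) :
  0 < k < n -> iter k (@ordS n) i <> i.
Proof.
move=> /andP[k0 kn] /(congr1 val) /=; rewrite val_iter_ordS.
rewrite -[X in _ = X](modn_small (ltn_ord i)) -[X in _ = X %% _]addn0.
by move/eqP; rewrite eqn_modDl mod0n modn_small// => /eqP k_0; rewrite k_0 in k0.
Qed.

(** If the two edges matched with their ends swapped, [j] would be its own second successor, which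
    [3 <= n] forbids. *)
Lemma cycle_edge_inj (T : Type) (n : nat) (c : 'I_n -> T) (i j : 'I_n) :
  3 <= n -> injective c ->
  [set c i; c (ordS i)] = [set c j; c (ordS j)] -> i = j.
Proof.
move=> n3 ci eij; have [[ij _]|[ij ji]] := set2_inj eij; first exact: ci.
by have [] := @iter_ordS_neq n 2 j n3; rewrite /= -(ci _ _ ij) (ci _ _ ji).
Qed.

Lemma cycle_walk (T : Type) (n : nat) (c : 'I_n -> T) (i : 'I_n) (x y : T) :
  3 <= n -> injective c -> [set x; y] = [set c i; c (ordS i)] ->
  walk (range (fun j => [set c j; c (ordS j)]) `\ [set x; y]) x y.
Proof.
move=> n3 ci exy; set E := _ `\ _.
(* Go round the cycle the other way, starting after the [i]-th edge; fewer than [n] steps never use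
   that edge, and [n - 1] steps end at [c i]. *)
have around k : k < n -> walk E (c (ordS i)) (c (iter k (@ordS n) (ordS i))).
  elim: k => [|k IHk] kn; first exact: walk_refl.
  apply: walk_step (IHk (ltnW kn)) _; split; first by eexists.
  rewrite /= exy => /(cycle_edge_inj n3 ci); rewrite -iterSr.
  exact: iter_ordS_neq.
have n0 : 0 < n by exact: leq_trans n3.
have := around n.-1; rewrite -iterSr !prednK// leqnn => /(_ isT).
have -> : iter n (@ordS n) i = i.
  by apply: val_inj; rewrite /= val_iter_ordS modnDr modn_small.
move=> w; have [[-> ->]|[-> ->]] := set2_inj exy; last exact: w.
exact: walk_sym.
Qed.

Lemma walk_path (T : Type) (E : set (set T)) (x y : T) : walk E x y ->
  exists2 s : seq {classic T},
    path (fun a b : {classic T} => `[< E [set a; b] >]) x s & last x s = y.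
Proof.
elim=> [|u v _ [s xs su] uv]; first by exists [::].
exists (rcons s v); last by rewrite last_rcons.
by rewrite rcons_path xs su; apply/asboolP.
Qed.

(** Shortening the walk to a path without repeated vertices and closing it with the edge
    [[set x; y]] gives the cycle. *)
Lemma walk_cyclic (T : Type) (E : set (set T)) (x y : T) : x <> y ->
  E [set x; y] -> walk (E `\ [set x; y]) x y -> cyclic E.
Proof.
move=> xy Exy w; have [s0 xs0] := walk_path w.
case/shortenP: xs0 => s xs us _ sy.
exists (size s).+1, (fun i => nth (x : {classic T}) (x :: s) i).
have lastE : nth (x : {classic T}) (x :: s) (size s) = y.
  by rewrite -sy (last_nth x).
split.
(* An empty path would give [x = y], and a path of one edge would be the deleted edge itself. *)
- case: s xs sy {us lastE} => [|a [|b s]] //=.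
    by rewrite andbT => /asboolP[_ +] ay; rewrite /= -ay.
- move=> i j /(introT (@eqP {classic T} _ _)).
  by rewrite nth_uniq// => /eqP; exact: val_inj.
- move=> i; have := ltn_ord i; rewrite ltnS leq_eqVlt => /orP[/eqP iE|il].
    by rewrite /= iE modnn lastE setUC.
  rewrite [ordS i : nat]/= modn_small//.
  by have /asboolP[] := pathP (x : {classic T}) xs i il.
Qed.

(* A cycle of [F + f] must run through [f]: the rest of it joins the ends of [f]. *)
Lemma fundamental_cycle (T : Type) (F : set (set T)) (f : set T) :
  ~ cyclic F -> cyclic (F `|` [set f]) ->
  exists B : set (set T), [/\ finite_set B, B `<=` F `|` [set f] &
    forall x y, f = [set x; y] -> walk (B `\ f) x y].
Proof.
move=> acF [n [c [n3 ci cF]]].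
exists (range (fun j => [set c j; c (ordS j)])); split.
- exact: finite_image.
- by move=> _ [i _ <-].
have [i fi] : exists i, f = [set c i; c (ordS i)].
  apply: contrapT => nf; apply: acF; exists n, c; split=> // i.
  by have [//|/= ie] := cF i; case: nf; exists i.
by move=> x y fE; rewrite fE; apply: cycle_walk; rewrite // -fE; exact: fi.
Qed.

(** * Finite families of edges and extension of acyclic sets *)

Lemma finite_subsets (T : Type) (K : set T) :
  finite_set K -> finite_set [set B | B `<=` K].
Proof.
move=> /(@finite_seqP {classic T})[s ->]; elim: s => [|x s IHs].
  apply: (sub_finite_set _ (finite_set1 set0)) => B /= B0.
  by rewrite -subset0 => y /B0.
apply: (sub_finite_set (B := [set B | B `<=` [set` s]]
    `|` setU [set x] @` [set B | B `<=` [set` s]])); last first.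
  by rewrite finite_setU; split=> //; exact: finite_image.
move=> B Bxs; have [Bx|nBx] := EM (B x).
  right; exists (B `\ x) => [y [/Bxs/=]|].
    by rewrite inE => /orP[/eqP->|].
  by apply/seteqP; split=> [y [->|[]]//|y By]; have [->|] := EM (y = x); [left|right].
left=> y By; have := Bxs _ By; rewrite /= inE => /orP[/eqP yx|//].
by case: nBx; rewrite -yx.
Qed.

(** A cycle has finitely many edges, so a single member of the chain contains all those outside
    [A]. *)
Lemma chain_acyclic (T : Type) (A : set (set T)) (C : set (set (set T))) :
  ~ cyclic A -> total_on C subset -> (forall X, C X -> ~ cyclic (A `|` X)) ->
  ~ cyclic (A `|` \bigcup_(X in C) X).
Proof.
move=> acA totC acC [n [c [n3 ci cE]]].
(* [X = set0] serves as long as the first [k] edges all lie in [A]; it also covers an empty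
   chain. *)
have /(_ n)[X CX] k : exists2 X, (X = set0 \/ C X) &
    forall i : 'I_n, i < k -> (A `|` X) [set c i; c (ordS i)].
  elim: k => [|k [X CX IHk]]; first by exists set0; [left|].
  have [[j jk]|nj] := EM (exists j : 'I_n, j = k :> nat); last first.
    exists X => // i; rewrite ltnS leq_eqVlt => /orP[/eqP ik|/IHk//].
    by case: nj; exists i.
  have ext Y : X `<=` Y -> (A `|` Y) [set c j; c (ordS j)] ->
      forall i : 'I_n, i < k.+1 -> (A `|` Y) [set c i; c (ordS i)].
    move=> XY Yj i; rewrite ltnS leq_eqVlt => /orP[/eqP ik|/IHk].
      by have -> : i = j by apply: val_inj; rewrite /= ik.
    by case=> [|/XY]; [left|right].
  have [Aj|[Y CY Yj]] := cE j; first by exists X => //; apply: ext => //; left.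
  case: CX => [X0|CX]; first by exists Y; [right|apply: ext; [rewrite X0|right]].
  have [XY|YX] := totC _ _ CX CY.
    by exists Y; [right|apply: ext => //; right].
  by exists X; [right|apply: ext => //; right; apply: YX].
move=> XE; case: CX => [X0|CX].
  by apply: acA; exists n, c; split=> // i; have := XE i (ltn_ord i); rewrite X0 setU0.
by apply: (acC _ CX); exists n, c; split=> // i; apply: XE.
Qed.

Lemma maximal_acyclic (T : Type) (A X : set (set T)) :
  ~ cyclic A -> A `<=` X ->
  exists M : set (set T), [/\ A `<=` M, M `<=` X, ~ cyclic M &
    forall f, X f -> ~ M f -> cyclic (M `|` [set f])].
Proof.
move=> acA AX.
(* Zorn is applied to the sets [M] with [A] joined to [M] acyclic, rather than to those containing
   [A]: the empty chain has union [set0], which must qualify. *)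
have [|M [[MX acM] maxM]] :=
    @Zorn_bigcup _ [set M | M `<=` X /\ ~ cyclic (A `|` M)].
  move=> C CP totC; split; first by apply: bigcup_sub => Y /(CP Y)[].
  by apply: chain_acyclic => // Y /(CP Y)[].
exists (A `|` M); split=> //.
  by rewrite subUset.
move=> f Xf nf; apply: contrapT => acf; apply: (maxM (M `|` [set f])).
  split; first by move=> e; left.
  by move=> /(_ f (or_intror erefl)) Mf; apply: nf; right.
by split; [rewrite subUset; split=> // _ ->|rewrite setUA].
Qed.

Definition is_edge (T : Type) (e : set T) : Prop :=
  exists x y, x <> y /\ e = [set x; y].

(* In a maximal acyclic [A] contained in [D], any edge of [D] with an end not
   covered by [A] would be pendant, so it could be added to [A]. *)
Lemma infinite_acyclic (T : Type) (D : set (set T)) :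
  D `<=` @is_edge T -> infinite_set D ->
  exists A, [/\ A `<=` D, infinite_set A & ~ cyclic A].
Proof.
move=> De Dinf.
have ac0 : ~ cyclic (set0 : set (set T)).
  by move=> [n [c [n3 _ c0]]]; exact: (c0 (Ordinal (leq_trans (isT : 0 < 3) n3))).
have [A [_ AD acA maxA]] := maximal_acyclic ac0 (sub0set D).
exists A; split=> // finA; apply: Dinf.
have finV : finite_set (\bigcup_(e in A) e).
  by apply: bigcup_finite => // e /AD/De[x [y [_ ->]]]; exact: finite_set2.
(* It suffices that every edge of [D] is a subset of the finite set of vertices covered by [A]. *)
apply: sub_finite_set (finite_subsets finV) => e eD z ez.
have [Ae|nAe] := EM (A e); first by exists e.
have [B [_ BAe Bw]] := fundamental_cycle acA (maxA _ eD nAe).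
have [x [y [xy exy]]] := De _ eD.
(* The walk along the rest of the fundamental cycle reaches [v] by an edge other than [e], hence by
   an edge of [A]. *)
have covered u v : u <> v -> e = [set u; v] -> (\bigcup_(e in A) e) v.
  move=> uv euv; have := Bw u v euv; move: uv => /[swap] -[//|w v' _].
  by move=> [/BAe[]// A'] _ _; exists [set w; v'] => //; right.
rewrite exy in ez; case: ez => /= ->.
  by apply: (covered y) => [yx|]; [exact: xy|rewrite exy setUC].
exact: (covered x).
Qed.

(** * Maximal forests and the forest graph *)

Lemma edges_is_edge (H : sgraph) : @edges H `<=` @is_edge (vertex H).
Proof.
move=> _ [x [y [xy ->]]]; exists x, y; split=> // xE.
by apply: (@adj_irrefl H y); rewrite -{1}xE.
Qed.

Lemma subgraph_eq (H : sgraph) (F F' : subgraph H) :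
  sub_vertices F = sub_vertices F' -> sub_edges F = sub_edges F' -> F = F'.
Proof.
case: F F' => [V E EH EV] [V' E' EH' EV'] /= VV' EE'.
by subst V' E'; congr Subgraph; exact: Prop_irrelevance.
Qed.

(** Adding isolated vertices creates no cycle, so a maximal forest spans. Testing one new edge at a
    time suffices, since acyclicity passes to subsets. As [has_cycle F] unfolds to
    [cyclic (sub_edges F)], the lemmas on bare edge sets apply. *)
Lemma maximal_forestP (H : sgraph) (F : subgraph H) :
  maximal_forest F <-> [/\ sub_vertices F = setT, ~ cyclic (sub_edges F) &
    forall f, edges f -> ~ sub_edges F f -> cyclic (sub_edges F `|` [set f])].
Proof.
split=> [[acF maxF]|[FT acF maxF]].
  have FT : sub_vertices F = setT.
    apply: contrapT => nFT; apply: maxF.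
    exists (Subgraph (@sub_edgesH H F) (fun _ _ => @subsetT _ _)).
    by split=> //; [split|move=> FE; apply: nFT; rewrite -FE].
  split=> // f fH nFf; apply: contrapT => acf; apply: maxF.
  have EH : sub_edges F `|` [set f] `<=` @edges H.
    by move=> e [/sub_edgesH//|->].
  exists (Subgraph EH (fun _ _ => @subsetT _ _)); split=> //.
    by split; [|move=> e; left].
  by move=> FE; apply: nFf; rewrite -FE; right.
split=> // -[F' [acF' [VV' EE'] F'F]]; apply: F'F; apply: subgraph_eq.
  by rewrite FT; apply/seteqP; split=> // x _; apply: VV'; rewrite FT.
apply/seteqP; split=> // e F'e; apply: contrapT => nFe; apply: acF'.
apply: subset_cyclic (maxF e (sub_edgesH F'e) nFe).
by rewrite subUset; split=> // _ ->.
Qed.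

(* An edge outside [K], the union of the fundamental cycles of [F0], is a
   bridge: deleting it from [F0] separates no pair of adjacent vertices other
   than its own ends.  So it lies in every maximal forest, and a maximal forest
   is determined by its trace on the finite set [K]. *)
Lemma finite_forest_graph (H : sgraph) (F0 : subgraph H) :
  maximal_forest F0 -> finite_set (@edges H `\` sub_edges F0) ->
  finite_set [set: vertex (forest_graph H)].
Proof.
move=> /maximal_forestP[_ acF0 maxF0] finD.
set D := _ `\` _ in finD; set E0 := sub_edges F0.
have /choice[B BP] : forall f, exists B, D f ->
    [/\ finite_set B, B `<=` E0 `|` [set f] &
     forall x y, f = [set x; y] -> walk (B `\ f) x y].
  move=> f; have [[fH nf]|nDf] := EM (D f); last by exists set0.
  by have [B ?] := fundamental_cycle acF0 (maxF0 f fH nf); exists B.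
pose K := (\bigcup_(f in D) B f) `|` D.
have finK : finite_set K.
  by rewrite finite_setU; split=> //; apply: bigcup_finite => // f /BP[].
have bridge F e : maximal_forest F -> edges e -> ~ K e -> sub_edges F e.
  move=> /maximal_forestP[_ acF maxF] eH nKe; apply: contrapT => nFe.
  have [C [_ CF Cw]] := fundamental_cycle acF (maxF e eH nFe).
  have [x [y [xy exy]]] := edges_is_edge eH.
  have E0e : E0 e by apply: contrapT => nE0; apply: nKe; right.
  apply: acF0; apply: (walk_cyclic xy); first by rewrite -exy.
  (* Reroute the rest of [C] inside [E0]: each edge outside [E0] is replaced by the rest of its
     fundamental cycle, which avoids [e] because [e] is not in [K]. Together with [e] this closes a
     cycle in [F0]. *)
  rewrite -exy; apply: walk_sub (Cw x y exy) => a b [/CF[|//] Fab abe].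
  set g := [set a; b]; have [E0g|nE0g] := EM (E0 g).
    exact: walk_step (walk_refl _ _) _.
  have Dg : D g by split=> //; exact: sub_edgesH Fab.
  have [_ BE Bw] := BP g Dg.
  apply: walk_sub (Bw a b erefl) => u v [Buv uvg].
  apply: walk_step (walk_refl _ _) _; split; first by case: (BE _ Buv).
  by move=> /= uve; apply: nKe; left; exists g => //; rewrite -uve.
pose trace (F : vertex (forest_graph H)) := sub_edges (sval F) `&` K.
have : finite_set (trace @^-1` [set L | L `<=` K]).
  apply: finite_preimage (finite_subsets finK) => -[F Fm] [F' Fm'] _ _.
  rewrite /trace /= => FF'.
  have le F1 F2 : maximal_forest F2 -> sub_edges F1 `&` K = sub_edges F2 `&` K ->
      sub_edges F1 `<=` sub_edges F2.
    move=> F2m tr e F1e; have [Ke|nKe] := EM (K e).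
      by have : (sub_edges F1 `&` K) e by []; rewrite tr => -[].
    exact: bridge (sub_edgesH F1e) nKe.
  apply: eq_exist; apply: subgraph_eq.
    have [-> _ _] := (maximal_forestP F).1 Fm.
    by have [-> _ _] := (maximal_forestP F').1 Fm'.
  by apply/seteqP; split; apply: le.
by apply: sub_finite_set => F _ e [].
Qed.

(** Each exchange brings in only one new edge. *)
Lemma exchange_path_finite (H : sgraph) (p : nat -> vertex (forest_graph H)) (n : nat) :
  (forall i, i < n -> adj (p i) (p i.+1)) ->
  finite_set (sub_edges (sval (p n)) `\` sub_edges (sval (p 0))).
Proof.
elim: n => [|n IHn] pE; first by rewrite setDv; exact: finite_set0.
have [e [f [_ _ _ ->]]] := pE n (ltnSn n).
have fin := IHn (fun i lt_in => pE i (ltnW lt_in)).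
have : finite_set ((sub_edges (sval (p n)) `\` sub_edges (sval (p 0))) `|` [set f]).
  by rewrite finite_setU; split=> //; exact: finite_set1.
by apply: sub_finite_set => g [[[Fg _]|gf] nF0]; [left|right].
Qed.

Lemma connected_forest_graph_finite (H : sgraph) :
  connected_graph (forest_graph H) -> finite_set [set: vertex (forest_graph H)].
Proof.
move=> conn; apply: contrapT => inf.
have [[F0 F0m] _] : [set: vertex (forest_graph H)] !=set0 by exact: infinite_setN0.
have Dinf : infinite_set (@edges H `\` sub_edges F0).
  by move=> finD; apply: inf; exact: finite_forest_graph F0m finD.
have [|A [AD Ainf acA]] := @infinite_acyclic (vertex H) _ _ Dinf.
  by move=> e [/edges_is_edge].
(* Extending [A] within the edges of [H] yields a maximal forest that contains all of [A], an
   infinite set of edges missing from [F0]. *)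
have [M [AM MH acM maxM]] :=
  maximal_acyclic acA (fun e Ae => (AD e Ae).1 : @edges H e).
pose F1 := Subgraph MH (fun _ _ => @subsetT _ _).
have F1m : maximal_forest F1 by apply/maximal_forestP.
have [n [p [p0 pn pE]]] := conn (exist _ F0 F0m) (exist _ F1 F1m).
apply: Ainf; have := exchange_path_finite pE; rewrite p0 pn /=.
by apply: sub_finite_set => e Ae; split; [exact: AM|case: (AD e Ae)].
Qed.

Theorem theorem4p2 (G : sgraph) :
  infinite_graph G -> connected_graph G -> ~ exists H : sgraph, forest_root H G.
Proof.
move=> Ginf Gconn [H [phi [psi phiK psiK] phiE]]; apply: Ginf.
have conn : connected_graph (forest_graph H).
  move=> x y; have [n [p [p0 pn pE]]] := Gconn (phi x) (phi y).
  exists n, (psi \o p); split; rewrite /= ?p0 ?pn ?phiK// => i lt_in.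
  by apply/phiE; rewrite !psiK; exact: pE.
have := finite_image phi (connected_forest_graph_finite conn).
by apply: sub_finite_set => x _; exists (psi x) => //; exact: psiK.
Qed.
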